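(* Let $G$ be a connected graph with $n \geq 2$ vertices. Then $$\left\lceil \frac{n}{2} \right\rceil \leq \tilde{\gamma}_{c}(M(G)) \leq n.$$
   Context: All graphs are non-empty, finite, undirected and simple. A dominating set of a graph $H$ is a set $S \subseteq V(H)$ such that $N_H[v] \cap S \neq \emptyset$ for every $v \in V(H)$, where $N_H[v]$ is the closed neighborhood of $v$. A dominating set $S$ of $H$ is an outer-connected dominating set if the graph $H - S$ (obtained by deleting the vertices in $S$) is connected. The outer-connected domination number $\tilde{\gamma}_c(H)$ is the minimum cardinality of an outer-connected dominating set of $H$. The middle graph $M(G)$ of a graph $G$ is the graph with vertex set $V(G) \cup E(G)$ (disjoint union), in which two vertices $x,y$ are adjacent if and only if either $x,y \in E(G)$ are distinct edges sharing an endpoint in $G$, or one of them is a vertex of $G$ and the other is an edge of $G$ incident with it. *)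

(* Defs.v *)
From mathcomp Require Import all_boot.

Set Implicit Arguments.
Unset Strict Implicit.
Unset Printing Implicit Defensive.

Record sgraph := SGraph {
  vertex :> finType;
  adj : rel vertex;
  adj_sym : symmetric adj;
  adj_irrefl : irreflexive adj
}.

(* The graph with no vertex is not connected: graphs are non-empty here. *)
Definition connected (G : sgraph) : bool :=
  (0 < #|G|) && [forall x : G, forall y : G, connect (@adj G) x y].

Definition closed_nbhd (G : sgraph) (v : G) : {set G} :=
  v |: [set w | adj v w].

Definition dominating (G : sgraph) (S : {set G}) : bool :=
  [forall v : G, closed_nbhd v :&: S != set0].

Section Delete.
Variables (G : sgraph) (S : {set G}).

Definition delete_vertex := {x : G | x \notin S}.

Definition delete_adj : rel delete_vertex := fun x y => adj (val x) (val y).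

Lemma delete_adj_sym : symmetric delete_adj.
Proof. by move=> x y; apply: adj_sym. Qed.

Lemma delete_adj_irrefl : irreflexive delete_adj.
Proof. by move=> x; apply: adj_irrefl. Qed.

Definition delete : sgraph := SGraph delete_adj_sym delete_adj_irrefl.

End Delete.

Definition outer_connected_dominating (G : sgraph) (S : {set G}) : bool :=
  dominating S && connected (delete S).

(* The neutral element #|G| bounds every #|S|, so it is the value only if
   it is attained or if G has no outer-connected dominating set. *)
Definition outer_connected_domination_number (G : sgraph) : nat :=
  \big[minn/#|G|]_(S : {set G} | outer_connected_dominating S) #|S|.

Lemma outer_connected_domination_number_le (G : sgraph) (S : {set G}) :
  outer_connected_dominating S -> outer_connected_domination_number G <= #|S|.
Proof.
move=> ocdS; rewrite /outer_connected_domination_number.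
have: S \in index_enum {set G} by rewrite mem_index_enum.
elim: (index_enum _) => [//|A s IHs]; rewrite inE big_cons.
case/orP=> [/eqP <-|/IHs le_s]; first by rewrite ocdS geq_minl.
by case: ifP => // _; apply: leq_trans (geq_minr _ _) le_s.
Qed.

Lemma outer_connected_domination_number_attained (G : sgraph) (S : {set G}) :
  outer_connected_dominating S ->
  exists2 A : {set G}, outer_connected_dominating A &
    #|A| = outer_connected_domination_number G.
Proof.
move=> ocdS; have := outer_connected_domination_number_le ocdS.
have: outer_connected_domination_number G = #|G| \/
    exists2 A : {set G}, outer_connected_dominating A &
      #|A| = outer_connected_domination_number G.
  rewrite /outer_connected_domination_number.
  elim/big_ind: _ => [|m n IHm IHn|A ocdA]; first by left.
    by rewrite /minn; case: ifP.
  by right; exists A.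
case=> [-> leGS|//]; exists S => //.
by apply/eqP; rewrite eqn_leq max_card.
Qed.

Definition edge_set (G : sgraph) : {set {set G}} :=
  [set e | [exists x : G, exists y : G, adj x y && (e == [set x; y])]].

Section MiddleGraph.
Variable G : sgraph.

Definition edge := {e : {set G} | e \in edge_set G}.

Definition middle_adj (x y : G + edge) : bool :=
  match x, y with
  | inl _, inl _ => false
  | inl v, inr e => v \in val e
  | inr e, inl v => v \in val e
  | inr e, inr f => (e != f) && (val e :&: val f != set0)
  end.

Lemma middle_adj_sym : symmetric middle_adj.
Proof. by move=> [v|e] [w|f] //=; rewrite eq_sym setIC. Qed.

Lemma middle_adj_irrefl : irreflexive middle_adj.
Proof. by move=> [v|e] //=; rewrite eqxx. Qed.

Definition middle_graph : sgraph := SGraph middle_adj_sym middle_adj_irrefl.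

End MiddleGraph.

(* Main.v *)
Require Import Defs.
From mathcomp Require Import all_boot.

Set Implicit Arguments.
Unset Strict Implicit.
Unset Printing Implicit Defensive.

(** The middle graph [M(G)] is the intersection graph of the singletons and
the edges of [G], regarded as sets of vertices of [G] ([middle_adjE]).  A
dominating set of [M(G)] is therefore a family of such sets that meets all
of them.  Both bounds follow from this description.

Lower bound: a family that meets every singleton covers the vertices of [G],
and each of its members has at most two elements, so twice its size is at
least [n] ([card_dominating_middle]).

Upper bound: the family of all singletons meets every edge, and what it
leaves is the line graph of [G], whose connectedness is inherited from [G]: a
walk in [G] is a chain of edges, consecutive ones sharing a vertex
([connected_delete_original]).  The hypothesis [2 <= n] provides an edge, so
that this line graph is not empty. *)

Section MiddleGraphIntersection.
Variable G : sgraph.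
Implicit Types (x y : middle_graph G) (u v w : G).

Definition ends x : {set G} :=
  match x with inl v => [set v] | inr e => val e end.

Lemma middle_adjE x y : adj x y = (x != y) && (ends x :&: ends y != set0).
Proof.
have set1I v (A : {set G}) : ([set v] :&: A != set0) = (v \in A).
  by rewrite setI_eq0 disjoints1 negbK.
case: x y => [v|e] [w|f]; rewrite ?[_ :&: [set w]]setIC ?set1I //=.
by rewrite inE [w == v]eq_sym; apply/esym/andNb.
Qed.

Lemma ends_neq0 x : ends x != set0.
Proof.
case: x => [v|[e he]] /=; apply/set0Pn; first by exists v; rewrite inE.
move: he; rewrite inE => /existsP[u /existsP[w /andP[_ /eqP->]]].
by exists u; rewrite !inE eqxx.
Qed.

Lemma card_ends_le2 x : #|ends x| <= 2.
Proof.
case: x => [v|[e he]] /=; first by rewrite cards1.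
move: he; rewrite inE => /existsP[u /existsP[w /andP[_ /eqP->]]].
by rewrite cards2; case: (u != w).
Qed.

Lemma edge_set_adj u v : adj u v -> [set u; v] \in edge_set G.
Proof.
move=> uv; rewrite inE; apply/existsP; exists u; apply/existsP; exists v.
by rewrite uv eqxx.
Qed.

Definition edge_of u v (uv : adj u v) : edge G :=
  exist (fun e => e \in edge_set G) [set u; v] (edge_set_adj uv).

Lemma dominating_middleP (S : {set middle_graph G}) :
  reflect (forall x, exists2 y, y \in S & ends x :&: ends y != set0)
          (dominating S).
Proof.
apply: (iffP forallP) => domS x.
  have /set0Pn[y] := domS x; rewrite !inE => /andP[/orP[/eqP->|xy] yS].
    by exists x => //; rewrite setIid ends_neq0.
  by exists y => //; move: xy; rewrite middle_adjE => /andP[].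
have [y yS meet_xy] := domS x; apply/set0Pn; exists y.
by rewrite !inE middle_adjE yS meet_xy !andbT eq_sym orbN.
Qed.

(** For a vertex [v] of [G], being dominated means lying in [ends x] for some
[x \in S]; thus the sets [ends x], each of size at most 2, cover [G]. *)
Lemma card_dominating_middle (S : {set middle_graph G}) :
  dominating S -> #|G| <= #|S|.*2.
Proof.
move=> /dominating_middleP domS.
have coverV : [set: G] \subset \bigcup_(x in S) ends x.
  apply/subsetP => v _; have [y yS] := domS (inl v).
  rewrite /= setI_eq0 disjoints1 negbK => v_y.
  by apply/bigcupP; exists y.
rewrite -cardsT; apply: leq_trans (subset_leq_card coverV) _.
apply: (@leq_trans (\sum_(x in S) #|ends x|)).
  elim/big_rec2: _ => [|x m A _ leAm]; first by rewrite cards0.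
  by rewrite (leq_trans (leq_card_setU _ _)) // leq_add2l.
rewrite -muln2 -sum_nat_const; apply: leq_sum => x _.
exact: card_ends_le2.
Qed.

Definition original_vertices : {set middle_graph G} := [set inl v | v : G].

Lemma card_original_vertices : #|original_vertices| = #|G|.
Proof. by rewrite card_imset // => u v []. Qed.

Lemma edge_not_original (e : edge G) :
  (inr e : middle_graph G) \notin original_vertices.
Proof. by apply/imsetP => -[]. Qed.

Definition remaining_edge (e : edge G) : delete original_vertices :=
  exist (fun x => x \notin original_vertices) (inr e) (edge_not_original e).

Lemma dominating_original : dominating original_vertices.
Proof.
apply/dominating_middleP => x; have /set0Pn[v v_x] := ends_neq0 x.
exists (inl v); first exact: imset_f.
by apply/set0Pn; exists v; rewrite !inE v_x eqxx.
Qed.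

Lemma connect_common_end (S : {set middle_graph G}) (a b : delete S) v :
  v \in ends (val a) -> v \in ends (val b) -> connect (@adj (delete S)) a b.
Proof.
move=> va vb; have [->|neq_ab] := eqVneq a b; first exact: connect0.
apply: connect1; change (adj (val a) (val b)).
rewrite middle_adjE (inj_eq val_inj) neq_ab /=.
by apply/set0Pn; exists v; rewrite inE va.
Qed.

(** Each step [v -- w] of a walk in [G] is itself a vertex of the line graph;
going through it replaces the current end [v] by [w]. *)
Lemma connect_along_path v p (a b : delete original_vertices) :
    path (@adj G) v p -> v \in ends (val a) -> last v p \in ends (val b) ->
  connect (@adj (delete original_vertices)) a b.
Proof.
elim: p v a => [|w p IHp] v a /=; first by move=> _; apply: connect_common_end.
case/andP=> vw path_p va last_b.
apply: (@connect_trans _ _ (remaining_edge (edge_of vw))).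
  by apply: connect_common_end va _; rewrite !inE eqxx.
by apply: IHp path_p _ last_b; rewrite !inE eqxx orbT.
Qed.

Lemma connected_delete_original :
  connected G -> 2 <= #|G| -> connected (delete original_vertices).
Proof.
move=> /andP[_ /forallP G_conn] G_ge2; apply/andP; split.
  have /card_gt1P[u [v [_ _ neq_uv]]] := G_ge2.
  have /connectP[[|w p] /=] := forallP (G_conn u) v.
    by move=> _ eq_vu; rewrite eq_vu eqxx in neq_uv.
  case/andP=> uw _ _; apply/card_gt0P.
  by exists (remaining_edge (edge_of uw)).
apply/forallP => a; apply/forallP => b.
have /set0Pn[u ua] := ends_neq0 (val a).
have /set0Pn[v vb] := ends_neq0 (val b).
have /connectP[p path_p eq_v] := forallP (G_conn u) v.
by apply: connect_along_path path_p ua _; rewrite -eq_v.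
Qed.

End MiddleGraphIntersection.

Theorem theorem4p1 (G : sgraph) (n : nat) (hn : #|G| = n) (n_ge2 : 2 <= n)
    (G_conn : connected G) :
  uphalf n <= outer_connected_domination_number (middle_graph G) <= n.
Proof.
have ocdV : outer_connected_dominating (original_vertices G).
  rewrite /outer_connected_dominating dominating_original.
  by apply: connected_delete_original; rewrite ?hn.
apply/andP; split; last first.
  by rewrite -hn -card_original_vertices outer_connected_domination_number_le.
have [A /andP[domA _] <-] := outer_connected_domination_number_attained ocdV.
by rewrite leq_uphalf_double -hn card_dominating_middle.
Qed.
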